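(* Let $R$ be a finite local ring with maximal ideal $M$ of order $m$, and let $k\ge1$ be an integer. (a) If $|R|/m\equiv1\pmod4$, then $$s_k(\mathcal{G}_R)=\frac{m^k(|R|/m-1)}{2^{k+1}}\left(2(|R|/m-1)^{k-1}+\left(-1+\sqrt{|R|/m}\right)^k+\left(-1-\sqrt{|R|/m}\right)^k\right).$$ (b) If $|R|/m\equiv3\pmod4$, then $s_k(\mathcal{G}_R)=m^k(|R|/m-1)\left((|R|/m-1)^{k-1}+(-1)^k\right)$.
   Context: A local ring is a commutative ring (with $1\neq0$) with a unique maximal ideal; $R^\times$ is its unit group, $Q_R=\{u^2:u\in R^\times\}$, $T_R=Q_R\cup(-Q_R)$, and the quadratic unitary Cayley graph $\mathcal{G}_R$ has vertex set $R$ with $x,y$ adjacent iff $x-y\in T_R$. For a graph $G$ with adjacency eigenvalues $\lambda_1,\dots,\lambda_n$ (with multiplicity), the $k$-th spectral moment is $s_k(G)=\sum_{i=1}^n\lambda_i^k$. *)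

(* Defs.v *)
From HB Require Import structures.
From mathcomp Require Import all_boot all_order all_fingroup all_algebra all_field.
Set Implicit Arguments.
Unset Strict Implicit.
Unset Printing Implicit Defensive.
Import Order.TTheory GRing.Theory Num.Theory.
Local Open Scope ring_scope.

(* MathComp's [idealr_closed] already requires [1 \notin I], so it describes
   the proper ideals. *)
Definition maximal_ideal (R : finComUnitRingType) (M : {set R}) : Prop :=
  idealr_closed M /\
  forall I : {set R}, idealr_closed I -> M \subset I -> I = M.

Definition is_local_ring (R : finComUnitRingType) : Prop :=
  exists! M : {set R}, maximal_ideal M.

Definition unit_squares (R : finComUnitRingType) : {set R} :=
  [set u ^+ 2 | u : R & u \is a GRing.unit].

Definition signed_unit_squares (R : finComUnitRingType) : {set R} :=
  unit_squares R :|: [set - x | x in unit_squares R].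

Definition quad_unitary_cayley (R : finComUnitRingType) : rel R :=
  fun x y => x - y \in signed_unit_squares R.
Arguments quad_unitary_cayley R x y : clear implicits.

Lemma quad_unitary_cayley_sym (R : finComUnitRingType) :
  symmetric (quad_unitary_cayley R).
Proof.
have S x : x \in signed_unit_squares R -> - x \in signed_unit_squares R.
  rewrite !inE => /orP[xQ|/imsetP[y yQ ->]]; last by rewrite opprK yQ.
  by apply/orP; right; apply: imset_f.
by move=> x y; apply/idP/idP => /S; rewrite opprB.
Qed.

Lemma quad_unitary_cayley_irr (R : finComUnitRingType) :
  irreflexive (quad_unitary_cayley R).
Proof.
have Q0 : (0 \in unit_squares R) = false.
  apply/imsetP => -[u]; rewrite inE => uU /esym u0.
  by have := unitrX 2 uU; rewrite u0 unitr0.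
move=> x; rewrite /quad_unitary_cayley subrr inE Q0 /=.
by apply/imsetP => -[y yQ /esym/eqP]; rewrite oppr_eq0 => /eqP y0; rewrite y0 Q0 in yQ.
Qed.

(* [#|R|] divided by [#|M|] as a natural number; the division is exact
   when [M] is an ideal. *)
Definition residue_card (R : finComUnitRingType) (M : {set R}) : nat :=
  (#|R| %/ #|M|)%N.

Lemma residue_cardK (R : finComUnitRingType) (M : {set R}) :
  idealr_closed M -> (residue_card M * #|M|)%N = #|R|.
Proof.
move=> idM; have [M0 MB] := idealr_closedB idM.
have gM : group_set M.
  apply/group_setP; split=> // x y xM yM.
  have NyM : 0 - y \in M by apply: MB.
  by have := MB _ _ xM NyM; rewrite sub0r opprK.
by rewrite divnK // -cardsT; apply: (cardSg (subsetT (group gM))).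
Qed.

Definition adjacency_mx (T : finType) (e : rel T) : 'M[algC]_#|T| :=
  \matrix_(i, j) (e (enum_val i) (enum_val j))%:R.

(* The eigenvalues, listed with multiplicity: the roots of the (monic)
   characteristic polynomial. *)
Definition eigenvalues (n : nat) (A : 'M[algC]_n) : seq algC :=
  sval (closed_field_poly_normal (char_poly A)).

Lemma eigenvaluesE (n : nat) (A : 'M[algC]_n) :
  char_poly A = \prod_(z <- eigenvalues A) ('X - z%:P).
Proof.
rewrite /eigenvalues; case: closed_field_poly_normal => r /= {1}->.
by rewrite (monicP (char_poly_monic A)) scale1r.
Qed.

Definition spectral_moment (T : finType) (e : rel T) (k : nat) : algC :=
  \sum_(z <- eigenvalues (adjacency_mx e)) z ^+ k.

(* Main.v *)
(* When q is odd, 2 is a unit of R, so squaring on the unit group has kernel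
   {1, -1}, the unit squares Q have index 2 among the units, and 1 + M is
   contained in Q.  Counting Q modulo 2 shows that -1 is in Q iff q = 1 mod 4.
   The adjacency matrix A lies in the span of the circulant matrices J, B and S
   of the constant 1, the indicator of M and the quadratic character chi
   (extended by 0 to M): A = J - B if q = 3 mod 4, A = (J - B + S) / 2 if
   q = 1 mod 4.  Writing n = |R| = q m, these matrices satisfy J^2 = n J,
   B^2 = m B, BJ = m J, BS = m S, SJ = 0 and, if -1 is in Q, S^2 = n B - m J.
   Hence the columns of J and of n B - m J, resp. n B - m J +- m sqrt(q) S, are
   eigenvectors of A, which gives the powers of A and their traces; since A is
   normal, the trace of A^k is the k-th spectral moment. *)
Require Import Defs.
From mathcomp Require Import all_boot all_order all_fingroup all_algebra all_field.
From mathcomp Require Import ring zify.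
Set Implicit Arguments.
Unset Strict Implicit.
Unset Printing Implicit Defensive.
Import Order.TTheory GRing.Theory Num.Theory.
Local Open Scope ring_scope.

(** * Spectral moments of a normal matrix as traces of its powers *)

Lemma char_poly_conj (F : fieldType) (n : nat) (P A : 'M[F]_n) :
  P \in unitmx -> char_poly (invmx P *m A *m P) = char_poly A.
Proof.
move=> uP; have defXM : 'X%:M = map_mx polyC (invmx P) *m 'X%:M *m map_mx polyC P.
  by rewrite -mulmxA -scalar_mxC mulmxA -map_mxM mulVmx // map_mx1 mul1mx.
rewrite /char_poly /char_poly_mx {1}defXM !map_mxM -mulmxBl -mulmxBr.
rewrite !det_mulmx !det_map_mx mulrAC -polyCM -det_mulmx mulVmx //.
by rewrite det1 mul1r.
Qed.

Lemma diag_mxX (F : comPzRingType) (n k : nat) (d : 'rV[F]_n) :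
  diag_mx d ^+ k = diag_mx (\row_j d 0 j ^+ k).
Proof.
elim: k => [|k IHk].
  by apply/matrixP=> i j; rewrite !mxE.
rewrite exprS IHk -mulmxE mulmx_diag; congr diag_mx.
by apply/rowP=> j; rewrite !mxE exprS.
Qed.

Lemma conjmx_exp (F : fieldType) (n k : nat) (P A : 'M[F]_n) :
  P \in unitmx -> (invmx P *m A *m P) ^+ k = invmx P *m A ^+ k *m P.
Proof.
move=> uP; elim: k => [|k IHk]; first by rewrite !expr0 mulmx1 mulVmx.
by rewrite !exprS IHk -!mulmxE !mulmxA mulmxK.
Qed.

(** By the spectral theorem [A] is similar to a diagonal matrix [diag_mx d]. Similarity preserves
    the characteristic polynomial, so the entries of [d] are the eigenvalues with multiplicity, and
    it preserves the traces of powers. *)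
Lemma sum_eigenvalues_exp (n k : nat) (A : 'M[algC]_n) :
  A \is normalmx -> \sum_(z <- eigenvalues A) z ^+ k = \tr (A ^+ k).
Proof.
move=> /orthomx_spectralP defA; have uP := spectral_unit A.
set P := spectralmx A in defA uP; set d := spectral_diag A in defA.
have: perm_eq (eigenvalues A) [seq d 0 i | i : 'I_n].
  apply: prod_XsubC_eq; rewrite -eigenvaluesE {1}defA char_poly_conj //.
  rewrite char_poly_trig ?diag_mx_is_trig // big_image /=.
  by apply: eq_bigr => i _; rewrite !mxE eqxx.
move=> /(perm_big _) ->; rewrite {1}defA conjmx_exp // mxtrace_mulC mulmxA.
rewrite mulmxV // mul1mx diag_mxX mxtrace_diag big_image /=.
by apply: eq_bigr => i _; rewrite mxE.
Qed.

Lemma spectral_moment_tr (T : finType) (e : rel T) (k : nat) :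
  symmetric e -> spectral_moment e k = \tr (adjacency_mx e ^+ k).
Proof.
move=> eC; apply/sum_eigenvalues_exp/symmetric_normalmx.
  apply/is_hermitianmxP; rewrite expr0 scale1r map_mx_id //.
  by apply/matrixP=> i j; rewrite !mxE eC.
by apply/mxOverP=> i j; rewrite mxE realn.
Qed.

(** Each column of [E] lies in the eigenspace of [a]; working with a whole matrix [E] avoids
    choosing eigenvectors. *)
Lemma eigen_mulX (F : comPzRingType) (n k : nat) (A E : 'M[F]_n) (a : F) :
  A *m E = a *: E -> A ^+ k *m E = a ^+ k *: E.
Proof.
move=> AE; elim: k => [|k IHk]; first by rewrite !expr0 mul1mx scale1r.
by rewrite exprSr -mulmxE -mulmxA AE -scalemxAr IHk scalerA exprS.
Qed.

(** * Circulant matrices over a finite abelian group *)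

Definition circulant_mx (R : finZmodType) (F : pzRingType) (f : R -> F) : 'M[F]_#|R| :=
  \matrix_(i, j) f (enum_val i - enum_val j).

(** The product is the convolution of the symbols: substitute [w = x - z] for the summation index
    [z] of the matrix product. *)
Lemma mul_circulant_mx (R : finZmodType) (F : pzRingType) (f g : R -> F) :
  circulant_mx f *m circulant_mx g =
  circulant_mx (fun c => \sum_w f w * g (c - w)).
Proof.
apply/matrixP=> i j; rewrite !mxE; set x := enum_val i; set y := enum_val j.
rewrite [RHS](reindex_inj (subrI x)) [RHS](reindex _ (onW_bij _ (enum_val_bij R))).
apply: eq_bigr => l _; rewrite !mxE opprB; congr (_ * g _).
by rewrite [RHS]addrC addrA subrK.
Qed.

Lemma circulant_mxC (R : finZmodType) (F : comPzRingType) (f g : R -> F) :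
  circulant_mx f *m circulant_mx g = circulant_mx g *m circulant_mx f.
Proof.
rewrite !mul_circulant_mx; apply/matrixP=> i j; rewrite !mxE.
set c := enum_val i - _; rewrite (reindex_inj (subrI c)).
by apply: eq_bigr => w _; rewrite subKr mulrC.
Qed.

Lemma tr_circulant_mx (R : finZmodType) (F : pzRingType) (f : R -> F) :
  \tr (circulant_mx f) = #|R|%:R * f 0.
Proof.
rewrite /mxtrace (eq_bigr (fun=> f 0)) => [|i _]; last by rewrite mxE subrr.
by rewrite sumr_const card_ord mulr_natl.
Qed.

(** * Parity of a finite set with an involution *)

Lemma odd_card_fixed (T : finType) (f : T -> T) (A : {set T}) :
  {in A, forall x, f x \in A} -> {in A, involutive f} ->
  odd #|A| = odd #|[set x in A | f x == x]|.
Proof.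
move: {2}#|A| (leqnn #|A|) => n; elim: n A => [|n IHn] A leAn fA fK.
  move: leAn; rewrite leqn0 cards_eq0 => /eqP->; congr (odd #|pred_of_set _|).
  by apply/setP=> x; rewrite !inE.
(* A moved point [x] is removed together with [f x], which changes neither the parity nor the fixed
   points; without moved points both sets agree. *)
have [x xA | A0] := pickP [pred x in A | f x != x]; last first.
  congr (odd #|pred_of_set _|); apply/setP=> x; rewrite inE.
  by have:= A0 x => /=; case: (x \in A) => //= /negbFE->.
case/andP: xA => xA fx.
pose B := A :\ x :\ f x.
have cA : #|A| = #|B|.+2.
  by rewrite (cardsD1 x) xA (cardsD1 (f x)) !inE fx fA.
have -> : [set y in A | f y == y] = [set y in B | f y == y].
  apply/setP=> y; rewrite !inE; have [->|nyx] := eqVneq y x.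
    by rewrite xA (negPf fx) !andbF.
  have [->|//] := eqVneq y (f x); rewrite fK // [x == _]eq_sym (negPf fx).
  by rewrite andbF.
rewrite cA /= negbK; apply: IHn; first by rewrite -ltnS ltnW // -cA.
  move=> y; rewrite !inE => /and3P[yfx yx yA]; rewrite fA // andbT.
  apply/andP; split; [apply: contraNneq yx|apply: contraNneq yfx] => e.
    by rewrite -(fK y yA) e fK.
  by rewrite -e fK.
by move=> y; rewrite !inE => /and3P[_ _ yA]; apply: fK.
Qed.

(** * Ideals and units of a finite local ring *)

Section LocalRing.
Variables (R : finComUnitRingType) (M : {set R}).
Implicit Types (u v x y z : R) (I : {set R}).

(** A boolean form of [idealr_closed], so that [maxset_exists] can extend a proper ideal to a
    maximal one. *)
Definition is_ideal I :=
  [&& 0 \in I, 1 \notin I & [forall a, forall x in I, forall y in I, a * x + y \in I]].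

Lemma is_idealP I : reflect (idealr_closed I) (is_ideal I).
Proof.
apply: (iffP and3P) => -[I0 I1 IS]; split=> //.
  by move=> a x y xI yI; apply: (forall_inP (forall_inP (forallP IS a) x xI)).
by apply/forallP=> a; apply/forall_inP=> x xI; apply/forall_inP=> y; apply: IS.
Qed.

(** A nonunit [x] generates a proper ideal, which lies in some maximal ideal; by uniqueness that
    ideal is [M]. Locality is used below only in this form. *)
Lemma unit_maximal_ideal x :
  is_local_ring R -> maximal_ideal M -> (x \is a GRing.unit) = (x \notin M).
Proof.
move=> [N [_ uniqN]] maxM; have [[M0 M1 MS] _] := maxM.
have [xM|xNM] /= := boolP (x \in M).
  by apply: contraNF M1 => Ux; rewrite -(mulVr Ux) -[X in X \in _]addr0 MS.
apply: contraNT xNM => Nx; pose I := [set x * a | a : R].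
have idI : is_ideal I.
  apply/is_idealP; split.
  - by apply/imsetP; exists 0; rewrite ?mulr0.
  - by apply: contraNN Nx => /imsetP[a _ a1]; apply/unitrPr; exists a.
  - move=> a _ _ /imsetP[b _ ->] /imsetP[c _ ->].
    by apply/imsetP; exists (a * b + c) => //; rewrite mulrDr mulrCA.
have [J /maxsetP[/is_idealP idJ maxJ] sIJ] := maxset_exists idI.
have maxJ' : maximal_ideal J.
  by split=> // K /is_idealP idK sJK; apply: maxJ.
rewrite -(uniqN _ maxM) (uniqN _ maxJ').
by apply: (subsetP sIJ); apply/imsetP; exists 1; rewrite ?mulr1.
Qed.

Section Ideal.
Hypothesis idM : idealr_closed M.

Lemma ideal0 : 0 \in M. Proof. by case: idM. Qed.
Lemma ideal1 : 1 \notin M. Proof. by case: idM. Qed.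
Lemma idealD x y : x \in M -> y \in M -> x + y \in M.
Proof. by case: idM => _ _ MS xM yM; rewrite -[x]mul1r MS. Qed.
Lemma idealMl a x : x \in M -> a * x \in M.
Proof. by case: idM => M0 _ MS xM; rewrite -[_ * _]addr0 MS. Qed.
Lemma idealN x : (- x \in M) = (x \in M).
Proof.
have N y : y \in M -> - y \in M by move=> yM; rewrite -mulN1r idealMl.
by apply/idP/idP => /N; rewrite ?opprK.
Qed.
Lemma idealDr x y : x \in M -> (y + x \in M) = (y \in M).
Proof.
move=> xM; apply/idP/idP=> [yxM|yM]; last exact: idealD.
by rewrite -(addrK x y) idealD ?idealN.
Qed.

(* Otherwise M together with 1 + M is an additive subgroup of order 2 |M|. *)
Lemma two_notin_ideal : odd (residue_card M) -> 2 \notin M.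
Proof.
move=> oddq; apply: contraTN oddq => M2.
pose H := M :|: [set 1 + x | x in M].
have gH : group_set H.
  apply/group_setP; split=> [|x y]; first by rewrite inE ideal0.
  have HE z : (z \in H) = (z \in M) || (z - 1 \in M).
    rewrite inE; congr (_ || _); apply/imsetP/idP=> [[w wM ->]|zM].
      by rewrite addrAC subrr add0r.
    by exists (z - 1); rewrite // addrC subrK.
  rewrite !HE -[(x * y)%g]/(x + y).
  case/orP=> xM /orP[] yM.
  - by rewrite (idealD xM yM).
  - by rewrite -addrA (idealD xM yM) orbT.
  - by rewrite addrAC (idealD xM yM) orbT.
  - have -> : x + y = x - 1 + (y - 1) + 2 by ring.
    by rewrite (idealD (idealD xM yM) M2).
have cH : #|H| = (2 * #|M|)%N.
  rewrite cardsU card_imset; last exact: addrI.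
  rewrite (_ : _ :&: _ = set0) ?cards0 ?subn0 ?mul2n ?addnn //.
  apply/setP=> x; rewrite !inE; apply/negP=> /andP[xM /imsetP[y yM ex]].
  by move: xM; rewrite ex idealDr // (negPf ideal1).
have: (#|group gH| %| #|[set: R]|)%N by rewrite cardSg ?subsetT.
rewrite cardsT /= cH -(residue_cardK idM) dvdn_pmul2r ?dvdn2 //.
by apply/card_gt0P; exists 0; rewrite ideal0.
Qed.

End Ideal.

(** * Squares of units when 2 is invertible *)

Section Squares.
Hypotheses (idM : idealr_closed M) (unitM : forall x, (x \is a GRing.unit) = (x \notin M)).
Hypothesis unit2 : (2 : R) \is a GRing.unit.
Let Q := unit_squares R.
Let U : {set R} := ~: M.

Lemma unit_squareP x :
  reflect (exists2 u, u \is a GRing.unit & x = u ^+ 2) (x \in Q).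
Proof.
by apply: (iffP imsetP) => -[u]; exists u; rewrite ?inE // in p *.
Qed.

Lemma unit_square_unit x : x \in Q -> x \is a GRing.unit.
Proof. by case/unit_squareP=> u Uu ->; rewrite unitrX. Qed.

Lemma unit_squareM x y : x \in Q -> y \in Q -> x * y \in Q.
Proof.
case/unit_squareP=> u Uu -> /unit_squareP[v Uv ->].
by apply/unit_squareP; exists (u * v); rewrite ?unitrM ?Uu ?exprMn.
Qed.

Lemma unit_squareV x : x \in Q -> x^-1 \in Q.
Proof.
case/unit_squareP=> u Uu ->.
by apply/unit_squareP; exists u^-1; rewrite ?unitrV ?exprVn.
Qed.

Lemma oppr_fixed x : - x = x -> x = 0.
Proof.
move/eqP; rewrite eq_sym -addr_eq0 -mulr2n -mulr_natl => /eqP x0.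
by rewrite -[x](mulKr unit2) x0 mulr0.
Qed.

(** In [(u - v) * (u + v) = 0] the factors add up to the unit [2 * u], so they are not both in [M].
    One of them is a unit, and the other vanishes. *)
Lemma eq_sqr_unit u v : u \is a GRing.unit ->
  (u ^+ 2 == v ^+ 2) = (v == u) || (v == - u).
Proof.
move=> Uu; apply/idP/idP; last by case/orP=> /eqP->; rewrite ?sqrrN.
rewrite -subr_eq0 subr_sqr; have [uv|] := boolP (u - v \in M).
  have Uuv : u + v \is a GRing.unit.
    rewrite unitM; apply/negP=> uvM.
    have e : 2 * u = u - v + (u + v) by ring.
    have : 2 * u \in M by rewrite e (idealD idM uv uvM).
    by apply/negP; rewrite -unitM unitrM unit2.
  by rewrite mulIr_eq0 ?subr_eq0 1?eq_sym => [->//|]; apply: mulIr.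
rewrite -unitM => Uuv; rewrite mulrI_eq0; last exact: mulrI.
by rewrite addrC addr_eq0 => ->; rewrite orbT.
Qed.

(** Negation is an involution of [M] whose only fixed point is 0. *)
Lemma odd_card_ideal : odd #|M|.
Proof.
rewrite (@odd_card_fixed _ (@GRing.opp R)).
- rewrite (_ : [set x in M | _] = [set 0]) ?cards1 //.
  apply/setP=> x; rewrite !inE; apply/andP/eqP=> [[_ /eqP/oppr_fixed]//|->].
  by rewrite ideal0 // oppr0.
- by move=> x; rewrite idealN.
- by move=> x _; rewrite /= opprK.
Qed.

(** The fibre of squaring over [u ^+ 2] is [{u, - u}], and [u != - u] because 2 is a unit. *)
Lemma card_unit_squares : #|U| = (2 * #|Q|)%N.
Proof.
rewrite -sum1_card (partition_big_imset (fun u => u ^+ 2)) /=.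
have -> : [set u ^+ 2 | u in U] = Q.
  apply/setP=> x; apply/imsetP/unit_squareP=> -[u Uu ->]; exists u => //.
    by rewrite unitM -in_setC.
  by rewrite inE -unitM.
rewrite (eq_bigr (fun=> 2)) ?sum_nat_const 1?mulnC // => x /unit_squareP[u Uu ->].
rewrite sum1dep_card (_ : [set _ | _] = [set u; - u]) ?cards2.
  have [/esym/oppr_fixed u0|//] := eqVneq u (- u).
  by move: Uu; rewrite u0 unitr0.
apply/setP=> v; rewrite !inE -unitM eq_sym eq_sqr_unit // andb_idl //.
by case/orP=> /eqP->; rewrite ?unitrN.
Qed.

(* u Q and the set of nonsquare units have the same cardinality. *)
Lemma nonsquareM u v : u \in U -> v \in U -> u \notin Q -> v \notin Q -> u * v \in Q.
Proof.
rewrite !inE -!unitM => Uu Uv uNQ vNQ.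
have sQU : [set u * x | x in Q] \subset U :\: Q.
  apply/subsetP=> _ /imsetP[x xQ ->]; rewrite !inE -unitM unitrM Uu unit_square_unit //.
  rewrite !andbT; apply: contra uNQ => uxQ.
  by rewrite -[u](mulrK (unit_square_unit xQ)) unit_squareM ?unit_squareV.
have cU : #|U| = (#|Q| + #|U :\: Q|)%N.
  rewrite -(cardsID Q U) (setIidPr _) //.
  by apply/subsetP=> x /unit_square_unit; rewrite unitM inE.
have := subset_leqif_cards sQU; rewrite card_imset; last exact: mulrI.
move/geq_leqif; rewrite -(leq_add2l #|Q|) -cU card_unit_squares mul2n addnn leqnn.
move/esym/eqP/setP/(_ v); rewrite !inE vNQ -unitM Uv /= => /imsetP[x xQ ->].
by rewrite mulrA unit_squareM //; apply/unit_squareP; exists u.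
Qed.

(* Squaring is injective on 1 + M, as -1 is not in 1 + M. *)
Lemma principal_unit_square x : x \in M -> 1 + x \in Q.
Proof.
move=> xM; pose V : {set R} := [set y | y - 1 \in M].
have unitV y : y \in V -> y \is a GRing.unit.
  rewrite inE unitM => yV; apply: contraNN (ideal1 idM) => yM.
  by rewrite -(subKr y 1) (idealD idM yM) // idealN // -opprB idealN.
have sqV : [set y ^+ 2 | y in V] = V.
  apply/eqP; rewrite eqEcard card_in_imset => [|y z yV zV /eqP].
    rewrite leqnn andbT; apply/subsetP=> _ /imsetP[y yV ->].
    by move: yV; rewrite !inE subr_sqr_1 mulrC; apply: idealMl.
  rewrite eq_sqr_unit ?unitV // => /orP[/eqP->//|/eqP zE].
  have : (y - 1) + (z - 1) \in M by move: yV zV; rewrite !inE; apply: idealD.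
  rewrite zE (_ : _ + _ = - 2); last by ring.
  by rewrite idealN // => M2; have := unit2; rewrite unitM M2.
have /imsetP[y /unitV Uy ->] : 1 + x \in [set y ^+ 2 | y in V].
  by rewrite sqV inE addrAC subrr add0r.
by apply/unit_squareP; exists y.
Qed.

(* On Q, negation has no fixed point if -1 is in Q, while inversion only fixes 1
   if -1 is not in Q. *)
Lemma oppr1_unit_square : (- 1 \in Q) = ~~ odd #|Q|.
Proof.
have N1 : - 1 != 1 :> R by apply/eqP=> /oppr_fixed/eqP; rewrite oner_eq0.
have [Q1|NQ1] := boolP (- 1 \in Q).
  rewrite (@odd_card_fixed _ (@GRing.opp R)); last by move=> x _; rewrite /= opprK.
    rewrite (_ : [set x in Q | _] = set0) ?cards0 //.
    apply/setP=> x; rewrite !inE; apply/andP=> -[/unit_square_unit Ux /eqP/oppr_fixed x0].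
    by move: Ux; rewrite x0 unitr0.
  by move=> x xQ; rewrite -mulN1r unit_squareM.
rewrite (@odd_card_fixed _ (@GRing.inv R)).
- rewrite (_ : [set x in Q | _] = [set 1]) ?cards1 //.
  apply/setP=> x; rewrite !inE; apply/andP/eqP=> [[xQ /eqP xV]|->]; last first.
    by rewrite invr1; split=> //; apply/unit_squareP; exists 1; rewrite ?unitr1 ?expr1n.
  have : 1 ^+ 2 == x ^+ 2 by rewrite expr1n expr2 -{1}xV mulVr ?unit_square_unit.
  rewrite eq_sqr_unit ?unitr1 // => /orP[/eqP//|/eqP xN1].
  by move: NQ1; rewrite -xN1 xQ.
- exact: unit_squareV.
- by move=> x _; rewrite /= invrK.
Qed.

(** * The quadratic character of the residue field, lifted to [R] *)

Definition quadratic_char x : algC :=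
  if x \in M then 0 else if x \in Q then 1 else - 1.
Local Notation chi := quadratic_char.

Lemma chi_ideal x : x \in M -> chi x = 0.
Proof. by rewrite /chi => ->. Qed.

Lemma chi_square x : x \in Q -> chi x = 1.
Proof. by move=> xQ; rewrite /chi -[x \in M]negbK -unitM unit_square_unit //= xQ. Qed.

Lemma chi_nonsquare x : x \notin M -> x \notin Q -> chi x = - 1.
Proof. by rewrite /chi => /negPf-> /negPf->. Qed.

Lemma chi_squareM x y : x \in Q -> chi (x * y) = chi y.
Proof.
move=> xQ; have Ux := unit_square_unit xQ.
have xyM : (x * y \in M) = (y \in M).
  by apply: negb_inj; rewrite -!unitM unitrM Ux.
have xyQ : (x * y \in Q) = (y \in Q).
  apply/idP/idP=> [xyQ|]; last exact: unit_squareM.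
  by rewrite -(mulKr Ux y) unit_squareM ?unit_squareV.
by rewrite /chi xyM xyQ.
Qed.

Lemma chiM x y : chi (x * y) = chi x * chi y.
Proof.
have [xM|xU] := boolP (x \in M).
  by rewrite (chi_ideal xM) mul0r chi_ideal // mulrC idealMl.
have [yM|yU] := boolP (y \in M).
  by rewrite (chi_ideal yM) mulr0 chi_ideal // idealMl.
have [xQ|xNQ] := boolP (x \in Q); first by rewrite chi_squareM // (chi_square xQ) mul1r.
have [yQ|yNQ] := boolP (y \in Q).
  by rewrite mulrC chi_squareM // (chi_square yQ) mulr1.
rewrite (chi_square (nonsquareM _ _ xNQ yNQ)) ?inE //.
by rewrite !chi_nonsquare // mulrNN mulr1.
Qed.

(** For a unit [x] the factor [1 + x^-1 * y] lies in [1 + M], hence is a square. *)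
Lemma chiD_ideal x y : y \in M -> chi (x + y) = chi x.
Proof.
move=> yM; have [xM|xU] := boolP (x \in M).
  by rewrite !chi_ideal ?idealD.
have Ux : x \is a GRing.unit by rewrite unitM.
have -> : x + y = (1 + x^-1 * y) * x by rewrite mulrDl mul1r [x^-1 * y]mulrC mulrVK.
by rewrite chi_squareM // principal_unit_square ?idealMl.
Qed.

(** Square and nonsquare units are equally numerous, since [Q] is half of [U]. *)
Lemma sum_chi : \sum_x chi x = 0.
Proof.
rewrite (bigID (mem M)) /= big1 => [|x /chi_ideal//]; rewrite add0r.
rewrite (bigID (mem Q)) /= (eq_bigr (fun=> 1)) => [|x /andP[_ /chi_square]//].
rewrite [X in _ + X](eq_bigr (fun=> - 1)) => [|x /andP[]]; last exact: chi_nonsquare.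
rewrite sumrN !sumr_const; apply/eqP; rewrite subr_eq0 eqr_nat; apply/eqP.
have sQU : Q \subset U by apply/subsetP=> x /unit_square_unit; rewrite unitM inE.
transitivity #|Q|.
  by apply: eq_card => x; rewrite unfold_in /= -in_setC andb_idl //; apply: (subsetP sQU).
apply/(@addnI #|Q|); rewrite addnn -mul2n -card_unit_squares -(cardsID Q U).
rewrite (setIidPr sQU); congr (_ + _)%N.
by apply: eq_card => x; rewrite [RHS]unfold_in !inE andbC.
Qed.

Let one_M x : algC := (x \in M)%:R.

(** The function is constant on the coset [c + M], the only part of [R] that contributes to the
    sum. *)
Lemma conv_ideal (f : R -> algC) c : (forall x y, y \in M -> f (x + y) = f x) ->
  \sum_w one_M w * f (c - w) = #|M|%:R * f c.
Proof.
move=> fM; rewrite mulr_natl -sumr_const [RHS]big_mkcond /=.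
apply: eq_bigr => w _; rewrite /one_M; case: ifP => wM; last by rewrite mul0r.
by rewrite mul1r fM // idealN.
Qed.

(** A Jacobi sum. For [c] in [M], [chi (c - w) = chi w], so each unit [w] contributes 1; for a unit
    [c] a substitution reduces the sum to [sum_chi]. *)
Lemma conv_chi c : - 1 \in Q ->
  \sum_w chi w * chi (c - w) = #|R|%:R * one_M c - #|M|%:R.
Proof.
move=> QN1; have chiN x : chi (- x) = chi x by rewrite -mulN1r chi_squareM.
have cRM : #|R|%:R - #|M|%:R = \sum_(w in U) 1 :> algC.
  by rewrite sumr_const -(cardsC M) natrD addrAC subrr add0r.
rewrite /one_M; have [cM|cU] := boolP (c \in M).
  rewrite mulr1 cRM [RHS]big_mkcond /=; apply: eq_bigr => w _.
  rewrite addrC chiD_ideal // chiN -chiM inE.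
  have [wM|wU] /= := boolP (w \in M); first by rewrite chi_ideal ?idealMl.
  by apply: chi_square; apply/unit_squareP; exists w; rewrite ?unitM.
have Uc : c \is a GRing.unit by rewrite unitM.
rewrite mulr0 sub0r.
(* chi w * chi (c - w) = chi (c / w - 1) for a unit w; substitute v = c / w.
   MathComp's w^-1 = w on nonunits keeps w |-> c * w^-1 bijective on all of R. *)
have h_inj : injective (fun w => c * w^-1) by move=> v w /(mulrI Uc)/invr_inj.
transitivity (\sum_(v in U) chi (v - 1)); last first.
  (* The sum over all [v] vanishes by translation, and each [v] in [M] contributes [chi (- 1) = 1],
     so the units contribute [- #|M|]. *)
  have : \sum_v chi (v - 1) = 0.
    by rewrite -[RHS]sum_chi [RHS](reindex_inj (addIr (- 1))).
  rewrite (bigID (mem M)) /= => /eqP; rewrite addr_eq0 => /eqP.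
  rewrite (eq_bigr (fun=> 1)) => [|v vM]; last by rewrite addrC chiD_ideal // chi_square.
  rewrite sumr_const => ->; rewrite opprK.
  by apply: eq_bigl => v; rewrite inE.
rewrite [RHS](reindex_inj h_inj) [RHS]big_mkcond /=; apply: eq_bigr => w _.
rewrite inE -unitM unitrM Uc unitrV /=; case: ifP => Uw; last first.
  by rewrite chi_ideal ?mul0r // -[_ \in _]negbK -unitM Uw.
have -> : c - w = (c * w^-1 - 1) * w by rewrite mulrBl mul1r mulrVK.
have wwQ : w * w \in Q by apply/unit_squareP; exists w.
by rewrite chiM mulrCA -chiM (chi_square wwQ) mulr1.
Qed.

(** * Multiplication table and traces of [J], [B] and [S] *)

Local Notation n := (#|R|%:R : algC).
Local Notation m := (#|M|%:R : algC).
Let J : 'M[algC]_#|R| := circulant_mx (fun=> 1).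
Let B : 'M[algC]_#|R| := circulant_mx one_M.
Let S : 'M[algC]_#|R| := circulant_mx chi.

Lemma mulBcirculant f : (forall x y, y \in M -> f (x + y) = f x) ->
  B *m circulant_mx f = m *: circulant_mx f.
Proof.
move=> fM; rewrite mul_circulant_mx; apply/matrixP=> i j; rewrite !mxE.
exact: conv_ideal.
Qed.

Lemma mulBJ : B *m J = m *: J.
Proof. exact: mulBcirculant. Qed.

Lemma mulBB : B *m B = m *: B.
Proof. by apply: mulBcirculant => x y yM; rewrite /one_M idealDr. Qed.

Lemma mulBS : B *m S = m *: S.
Proof. by apply: mulBcirculant => x y yM; rewrite chiD_ideal. Qed.

Lemma mulJJ : J *m J = n *: J.
Proof.
rewrite mul_circulant_mx; apply/matrixP=> i j; rewrite !mxE.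
by rewrite !mulr1 sumr_const.
Qed.

Lemma mulSJ : S *m J = 0.
Proof.
rewrite mul_circulant_mx; apply/matrixP=> i j; rewrite !mxE -[RHS]sum_chi.
by apply: eq_bigr => w _; rewrite mulr1.
Qed.

Lemma mulJB : J *m B = m *: J. Proof. by rewrite -mulBJ; apply: circulant_mxC. Qed.
Lemma mulJS : J *m S = 0. Proof. by rewrite -mulSJ; apply: circulant_mxC. Qed.
Lemma mulSB : S *m B = m *: S. Proof. by rewrite -mulBS; apply: circulant_mxC. Qed.

Lemma mulSS : - 1 \in Q -> S *m S = n *: B - m *: J.
Proof.
move=> QN1; rewrite mul_circulant_mx; apply/matrixP=> i j.
by rewrite !mxE conv_chi // mulr1.
Qed.

Lemma trJ : \tr J = n. Proof. by rewrite tr_circulant_mx mulr1. Qed.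
Lemma trB : \tr B = n. Proof. by rewrite tr_circulant_mx /one_M ideal0 ?mulr1. Qed.
Lemma trS : \tr S = 0. Proof. by rewrite tr_circulant_mx chi_ideal ?mulr0 ?ideal0. Qed.

(** * The adjacency matrix and the traces of its powers *)

Lemma adjacency_mx_nonsquare : - 1 \notin Q ->
  adjacency_mx (quad_unitary_cayley R) = J - B.
Proof.
move=> NQ1; apply/matrixP=> i j; rewrite !mxE /quad_unitary_cayley.
set x := enum_val i - _; rewrite /one_M.
(* If [- 1] is not a square, the negative of a nonsquare unit is a square, so every unit is a signed
   square. *)
have -> : (x \in signed_unit_squares R) = (x \notin M).
  rewrite inE -unitM; apply/orP/idP=> [[/unit_square_unit//|]|Ux].
    by case/imsetP=> y /unit_square_unit Uy ->; rewrite unitrN.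
  have [xQ|xNQ] := boolP (x \in Q); [by left | right].
  apply/imsetP; exists (- x); rewrite ?opprK // -mulN1r nonsquareM // inE -unitM //.
  by rewrite unitrN1.
by case: (x \in M); rewrite ?subrr ?subr0.
Qed.

(** Here [Q] is closed under negation, and its indicator is half of 1 minus the indicator of [M]
    plus [chi]. *)
Lemma adjacency_mx_square : - 1 \in Q ->
  adjacency_mx (quad_unitary_cayley R) = 2^-1 *: (J - B + S).
Proof.
move=> QN1; apply/matrixP=> i j; rewrite !mxE /quad_unitary_cayley.
set x := enum_val i - _; rewrite /one_M.
have -> : (x \in signed_unit_squares R) = (x \in Q).
  rewrite inE; apply: orb_idr => /imsetP[y yQ ->].
  by rewrite -mulN1r unit_squareM.
have [xM|xU] := boolP (x \in M).
  rewrite chi_ideal // addr0 subrr mulr0.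
  by have [/unit_square_unit|//] := boolP (x \in Q); rewrite unitM xM.
rewrite subr0; have [xQ|xNQ] := boolP (x \in Q).
  by rewrite chi_square // mulVf // pnatr_eq0.
by rewrite chi_nonsquare // subrr mulr0.
Qed.

Let m_neq0 : m != 0.
Proof. by rewrite pnatr_eq0 -lt0n; apply/card_gt0P; exists 0; apply: ideal0. Qed.

Let n_neq0 : n != 0.
Proof. by rewrite pnatr_eq0 -lt0n; apply/card_gt0P; exists 0. Qed.

(** [n B = E + m J] is a sum of eigenmatrices of [A = J - B], and [A B = m A] turns [A ^+ k.+1 B]
    into [m A ^+ k.+1]. This last step needs a factor [A], whence the positive exponent. *)
Lemma tr_expX_nonsquare k :
  \tr ((J - B) ^+ k.+1) = (n / m - 1) * (- m) ^+ k.+1 + (n - m) ^+ k.+1.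
Proof.
pose E := n *: B - m *: J.
have AJ : (J - B) *m J = (n - m) *: J by rewrite mulmxBl mulJJ mulBJ scalerBl.
have AB : (J - B) *m B = m *: (J - B) by rewrite mulmxBl mulJB mulBB scalerBr.
have AE : (J - B) *m E = (- m) *: E.
  rewrite mulmxBr -!scalemxAr AB AJ; apply/matrixP=> i j; rewrite !mxE; ring.
have AX : (n * m) *: (J - B) ^+ k.+1 = (- m) ^+ k.+1 *: E + (m * (n - m) ^+ k.+1) *: J.
  rewrite -scalerA -(eigen_mulX _ AE) -[(m * _) *: J]scalerA -(eigen_mulX _ AJ).
  rewrite mulmxBr -!scalemxAr subrK; congr (_ *: _).
  by rewrite exprSr -mulmxE -mulmxA AB -[in RHS]scalemxAr.
apply: (mulfI (mulf_neq0 n_neq0 m_neq0)).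
rewrite -mxtraceZ AX mxtraceD !mxtraceZ !linearB /= !mxtraceZ trB trJ.
by field.
Qed.

(** The same method, with [2 n B] split into three eigenmatrices; [t] is either square root of
    [n / m]. *)
Lemma tr_expX_square k (t : algC) : - 1 \in Q -> t ^+ 2 = n / m ->
  \tr ((2^-1 *: (J - B + S)) ^+ k.+1) =
    (n / m - 1) / 2 * ((m * (- 1 + t) / 2) ^+ k.+1 + (m * (- 1 - t) / 2) ^+ k.+1)
    + ((n - m) / 2) ^+ k.+1.
Proof.
move=> QN1 t2; set A := 2^-1 *: _.
have two_neq0 : 2 != 0 :> algC by rewrite pnatr_eq0.
have defn : n = t ^+ 2 * m by rewrite t2 mulfVK.
(* Put [F = n B - m J]. Then [S F = n m S] and [S S = F], so [F + c S] is an eigenmatrix of [S] when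
   [c ^+ 2 = n m = (m t) ^+ 2]; this gives [c = e m t] with [e] equal to 1 or -1. *)
pose E e := n *: B - m *: J + (e * m * t) *: S.
have AJ : A *m J = ((n - m) / 2) *: J.
  rewrite -scalemxAl mulmxDl mulmxBl mulJJ mulBJ mulSJ.
  by apply/matrixP=> i j; rewrite !mxE; ring.
have AB : A *m B = m *: A.
  rewrite -scalemxAl mulmxDl mulmxBl mulJB mulBB mulSB.
  by apply/matrixP=> i j; rewrite !mxE; ring.
have AS : A *m S = 2^-1 *: (n *: B - m *: J - m *: S).
  rewrite -scalemxAl mulmxDl mulmxBl mulJS mulBS mulSS //.
  by apply/matrixP=> i j; rewrite !mxE; ring.
have AE e : e = 1 \/ e = - 1 -> A *m E e = (m * (- 1 + e * t) / 2) *: E e.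
  move=> e1; rewrite mulmxDr mulmxBr -!scalemxAr AB AJ AS.
  apply/matrixP=> i j; rewrite !mxE; move: (J i j) (B i j) (S i j) => x y z.
  by rewrite defn; case: e1 => ->; field.
have AX : (2 * n * m) *: A ^+ k.+1 =
    (m * (- 1 + t) / 2) ^+ k.+1 *: E 1 + (m * (- 1 - t) / 2) ^+ k.+1 *: E (- 1)
    + (2 * m * ((n - m) / 2) ^+ k.+1) *: J.
  have -> : m * (- 1 + t) / 2 = m * (- 1 + 1 * t) / 2 by rewrite mul1r.
  have -> : m * (- 1 - t) / 2 = m * (- 1 + - 1 * t) / 2 by rewrite mulN1r.
  rewrite -(eigen_mulX _ (AE _ (or_introl erefl))) -(eigen_mulX _ (AE _ (or_intror erefl))).
  rewrite -[_ *: J]scalerA -(eigen_mulX _ AJ) scalemxAr -!mulmxDr.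
  have -> : E 1 + E (- 1) + (2 * m) *: J = (2 * n) *: B.
    by apply/matrixP=> i j; rewrite !mxE; ring.
  by rewrite -scalemxAr -[LHS]scalerA exprSr -mulmxE -mulmxA AB -[in RHS]scalemxAr.
apply: (mulfI (mulf_neq0 (mulf_neq0 two_neq0 n_neq0) m_neq0)).
have trE e : \tr (E e) = n * n - m * n.
  by rewrite mxtraceD linearB /= !mxtraceZ trB trJ trS mulr0 addr0.
rewrite -mxtraceZ AX !mxtraceD !mxtraceZ !trE trJ.
by field.
Qed.

End Squares.
End LocalRing.

Theorem theorem4p1 (R : finComUnitRingType) (M : {set R}) (k : nat)
    (R_local : is_local_ring R) (M_max : maximal_ideal M) (k_ge1 : (1 <= k)%N) :
  let m := #|M| in
  let q := residue_card M in
  (q = 1 %[mod 4] ->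
     spectral_moment (quad_unitary_cayley R) k =
       m%:R ^+ k * (q%:R - 1) / 2 ^+ k.+1 *
       (2 * (q%:R - 1) ^+ k.-1 + (- 1 + sqrtC q%:R) ^+ k
          + (- 1 - sqrtC q%:R) ^+ k)) /\
  (q = 3 %[mod 4] ->
     spectral_moment (quad_unitary_cayley R) k =
       m%:R ^+ k * (q%:R - 1) * ((q%:R - 1) ^+ k.-1 + (- 1) ^+ k)).
Proof.
move=> m q; have idM := M_max.1.
have unitM x := unit_maximal_ideal x R_local M_max.
have card_R : (q * m)%N = #|R| := residue_cardK idM.
have m_gt0 : (0 < m)%N by apply/card_gt0P; exists 0; apply: ideal0.
have nm : #|R|%:R / m%:R = q%:R :> algC.
  by rewrite -card_R natrM mulfK // pnatr_eq0 -lt0n.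
have nBm : #|R|%:R - m%:R = m%:R * (q%:R - 1) :> algC.
  by rewrite -card_R natrM; ring.
have unit2 : odd q -> (2 : R) \is a GRing.unit.
  by rewrite unitM; apply: two_notin_ideal.
have card_squares : odd q -> (m * q.-1 = 2 * #|unit_squares R|)%N.
  move=> /unit2 u2; rewrite -(card_unit_squares idM unitM u2) cardsCs setCK.
  by rewrite -card_R -/m -subn1 mulnBr muln1 mulnC.
case: k k_ge1 => // k _; rewrite spectral_moment_tr; last exact: quad_unitary_cayley_sym.
split=> q_mod.
  have q_odd : odd q by lia.
  have QN1 : - 1 \in unit_squares R.
    rewrite (oppr1_unit_square idM unitM (unit2 q_odd)).
    (* Since 4 divides [q - 1], the number of unit squares [m (q - 1) / 2] is even. *)
    have := card_squares q_odd; rewrite (_ : q.-1 = 2 * (2 * (q %/ 4)))%N; last by lia.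
    rewrite mulnCA => /eqP; rewrite eqn_pmul2l // => /eqP <-.
    by rewrite mulnCA oddM.
  rewrite (adjacency_mx_square unitM QN1).
  rewrite (tr_expX_square idM unitM (unit2 q_odd) _ QN1 (t := sqrtC q%:R)) ?sqrtCK ?nm // nBm.
  rewrite !expr_div_n !exprMn /= !exprS; field; rewrite expf_neq0 ?pnatr_eq0 //.
have q_odd : odd q by lia.
have QN1 : - 1 \notin unit_squares R.
  rewrite (oppr1_unit_square idM unitM (unit2 q_odd)).
  have := card_squares q_odd; have := odd_card_ideal idM (unit2 q_odd).
  (* Now [(q - 1) / 2] is odd, and so is [m], so the number of unit squares is odd. *)
  rewrite -/m (_ : q.-1 = 2 * (q %/ 4).*2.+1)%N => [m_odd|]; last by lia.
  rewrite mulnCA => /eqP; rewrite eqn_pmul2l // => /eqP <-.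
  by rewrite oddM m_odd /= odd_double.
rewrite (adjacency_mx_nonsquare idM unitM (unit2 q_odd) QN1).
rewrite (tr_expX_nonsquare idM) nm nBm [in X in X + _]exprNn !exprMn /= !exprS; ring.
Qed.
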